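(* Let $z\in(0,1-1/\sqrt2)$, $M>0$, $a>0$, $b,c\ge0$, $\tau=4(2+cz)/(az^2)$, and let $\{\Delta_m,m\in\mathcal M\}$ be nonnegative numbers with $\Sigma=\sum_{m\in\mathcal M}e^{-\Delta_m}<+\infty$ and $\Delta_m\ge1$ for all $m\in\mathcal M$. Assume that: (1) for all $y,\xi>0$, $\displaystyle\sup_{t,t'\in\mathcal B(s,y)}\mathbb P[Z(N,t,t')>\xi]\le b\exp\left[-\frac{a\xi^2}{y^2+c\xi}\right]$; (2) for each $m\in\mathcal M$, $\mathcal S_m=\{s_\lambda,\lambda\in\Lambda(m)\}$ is a discrete subset of $\mathcal L_0$ and there is $\eta_m\ge1/2$ such that for all $s'\in\mathcal L_0$ and $r\ge2\eta_m$, $|\mathcal S_m\cap\mathcal B(s',r\sqrt\tau)|\le M\exp(r^2/2)$. Let $\Lambda=\bigcup_{m}\Lambda(m)$, $\mathcal S=\bigcup_m\mathcal S_m$. By applying the selection procedure described in the context to the family $\{s_\lambda,\lambda\in\Lambda\}$ with $$\mathrm{pen}(t)=z\tau\inf\{4\eta_m^2+\Delta_m:\ m\in\mathcal M,\ t\in\mathcal S_m\}\quad\text{for all }t\in\mathcal S,$$ the resulting estimator $\tilde s=s_{\hat\lambda}$ satisfies $$\mathbb E[H^2(s,\tilde s)]\le C\inf_{m\in\mathcal M}\left[H^2(s,\mathcal S_m)+\tau(\eta_m^2\vee\Delta_m)\right],$$ where $C$ depends on $z,b,M$ and $\Sigma$ only. If moreover, for all $m\in\mathcal M$, $\mathcal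 S_m$ is an $(M,\eta_m\sqrt\tau,D_m)$-net for a subset $S_m$ of $\mathcal L_0$ with $\eta_m^2=2(D_m\vee1/8)$, then $$\mathbb E[H^2(s,\tilde s)]\le C'\inf_{m\in\mathcal M}\left[H^2(s,S_m)+\tau(D_m\vee\Delta_m)\right],$$ where $C'$ depends on $z,b,M$ and $\Sigma$ only.
   Context: Setting. $N_1,\dots,N_k$ are independent random measures on a probability space $(\Omega,\mathcal T,\mathbb P)$, $N_i$ taking values in the positive measures on a measured space $(\mathcal X_i,\mathcal A_i,\mu_i)$, with $\mathbb E[N_i(A)]=\int_A s_i\,d\mu_i<+\infty$ for all $A\in\mathcal A_i$, where $s_i\ge0$ is measurable. Write $N=(N_1,\dots,N_k)$, $s=(s_1,\dots,s_k)$ (the unknown intensity), $\mu=(\mu_1,\dots,\mu_k)$. $\mathcal L$ is the set of $k$-tuples of nonnegative measurable functions $t_i$ integrable on $(\mathcal X_i,\mathcal A_i,\mu_i)$; $\mathcal L_0\subset\mathcal L$ is a known subset containing $s$. All operations on $k$-tuples are componentwise, and $\int_{\mathcal X}f\,d\nu=\sum_{i=1}^k\int_{\mathcal X_i}f_i\,d\nu_i$. $H^2(t,t')=\frac12\int_{\mathcal X}(\sqrt t-\sqrt{t'})^2d\mu$, $H(t,\mathcal F)=\inf_{f\in\mathcal F}H(t,f)$, $\mathcal B(t,y)=\{t'\in\mathcal L_0:H(t,t')\le y\}$. The index set $\mathcal M$ is at most countable. $\rho_r(\nu,t)=\frac12\left[\int_{\mathcal X}\sqrt{tr}\,d\mu+\int_{\mathcal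 X}\sqrt{t/r}\,d\nu\right]$ (conventions $0/0=0$, $a/0=+\infty$ for $a>0$). $Z(N,t,t')=\int_{\mathcal X}\psi(t,t',x)\,dN-\int_{\mathcal X}\psi(t,t',x)\,s\,d\mu$, where (componentwise) $\psi(t,t',x)=\frac1{\sqrt2}\left[\sqrt{\frac1{1+t(x)/t'(x)}}-\sqrt{\frac1{1+t'(x)/t(x)}}\right]$. Nets. For $S\subset\mathcal L_0$, $\varepsilon>0$ and $M,D\ge0$, a set $\mathcal S\subset S$ is an $(M,\varepsilon,D)$-net for $S$ if for every $t\in S$ there is $t'\in\mathcal S$ with $H(t,t')\le\varepsilon$, and for all $s'\in\mathcal L_0$ and $r\ge2\varepsilon$, $|\{t\in\mathcal S:H(s',t)\le r\}|\le M\exp[D(r/\varepsilon)^2]$. Selection procedure. For $s_\lambda\ne s_{\lambda'}$ put, with $r=(s_\lambda+s_{\lambda'})/2$, $$\mathbf T(N,s_\lambda,s_{\lambda'})=\left[\rho_r(N,s_{\lambda'})-\tfrac12\int_{\mathcal X}s_{\lambda'}d\mu-\mathrm{pen}(s_{\lambda'})\right]-\left[\rho_r(N,s_\lambda)-\tfrac12\int_{\mathcal X}s_\lambda d\mu-\mathrm{pen}(s_\lambda)\right].$$ Let $\mathcal E(s_\lambda)$ be the set of those $s_{\lambda'}\ne s_\lambda$ with $\mathbf T(N,s_\lambda,s_{\lambda'})\ge0$, and $\mathcal D(s_\lambda)=\sup\{H^2(s_\lambda,s_{\lambda'}):s_{\lambda'}\in\mathcal E(s_\lambda)\}$ ($=0$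 if $\mathcal E(s_\lambda)=\varnothing$). Then $\hat\lambda$ is any element of $\Lambda$ with $\mathcal D(s_{\hat\lambda})\le\mathcal D(s_\lambda)+\tau$ for all $\lambda\in\Lambda$. *)

(* Defs.v *)
From HB Require Import structures.
From mathcomp Require Import all_boot all_order all_algebra.
From mathcomp Require Import all_classical all_reals all_analysis.
From mathcomp Require Import measurable_realfun.

Set Implicit Arguments.
Unset Strict Implicit.
Unset Printing Implicit Defensive.

Import Order.TTheory GRing.Theory Num.Theory.
Import numFieldNormedType.Exports.

Local Open Scope classical_set_scope.
Local Open Scope card_scope.
Local Open Scope ring_scope.
Local Open Scope ereal_scope.

(* A set of cardinality at most the real x; in particular it is finite. *)
Definition card_le_real (R : realType) (U : Type) (A : set U) (x : R) : Prop :=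
  exists2 n : nat, A #= `I_n & (n%:R <= x)%R.

Definition ktuple (R : realType) (k : nat) (d : 'I_k -> measure_display)
  (X : forall i, measurableType (d i)) : Type := forall i, X i -> R.

Section Hellinger.
Context {R : realType} {k : nat} {d : 'I_k -> measure_display}
  {X : forall i, measurableType (d i)}.
Variable mu : forall i, {measure set (X i) -> \bar R}.

Definition calL : set (ktuple R X) := [set t | forall i,
  (forall x, (0 <= t i x)%R) /\ (mu i).-integrable [set: X i] (EFin \o t i)].

Definition hell2 (t t' : ktuple R X) : \bar R :=
  (2^-1)%:E * \sum_(i < k)
    \int[mu i]_x ((Num.sqrt (t i x) - Num.sqrt (t' i x)) ^+ 2)%:E.

Definition hell (t t' : ktuple R X) : \bar R := sqrte (hell2 t t').

(* +oo when F is empty *)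
Definition hell_set (t : ktuple R X) (F : set (ktuple R X)) : \bar R :=
  ereal_inf [set hell t f | f in F].

Definition hell_ball (L0 : set (ktuple R X)) (t : ktuple R X) (y : R) :
  set (ktuple R X) := [set t' | L0 t' /\ hell t t' <= y%:E].

(* S is discrete for the topology of the Hellinger distance. *)
Definition hell_discrete (S : set (ktuple R X)) : Prop :=
  forall t, S t -> exists2 e : R, (0 < e)%R &
    forall t', S t' -> hell t t' < e%:E -> t' = t.

(* T is an (M, eps, D)-net for S. *)
Definition is_net (L0 : set (ktuple R X)) (M eps D : R)
    (T S : set (ktuple R X)) : Prop :=
  [/\ S `<=` L0, [/\ (0 < eps)%R, (0 <= M)%R & (0 <= D)%R],
      T `<=` S,
      (forall t, S t -> exists2 t', T t' & hell t t' <= eps%:E) &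
      (forall s' (r : R), L0 s' -> (2 * eps <= r)%R ->
        card_le_real [set t | T t /\ hell s' t <= r%:E]
          (M * expR (D * (r / eps) ^+ 2))%R)].

(* The division of \bar R satisfies 0 / 0 = 0 and a / 0 = +oo for a > 0,
   which are the conventions wanted here and in [psi]. *)
Definition rho (nu : forall i, {measure set (X i) -> \bar R})
    (r t : ktuple R X) : \bar R :=
  (2^-1)%:E *
  (\sum_(i < k) \int[mu i]_x (Num.sqrt (t i x * r i x)%R)%:E +
   \sum_(i < k) \int[nu i]_x sqrte ((t i x)%:E / (r i x)%:E)).

Definition psi (t t' : ktuple R X) (i : 'I_k) (x : X i) : \bar R :=
  ((Num.sqrt 2)^-1)%:E *
  (sqrte (1 / (1 + (t i x)%:E / (t' i x)%:E)) -
   sqrte (1 / (1 + (t' i x)%:E / (t i x)%:E))).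

Definition Zproc (s : ktuple R X) (nu : forall i, {measure set (X i) -> \bar R})
    (t t' : ktuple R X) : \bar R :=
  \sum_(i < k) \int[nu i]_x psi t t' x -
  \sum_(i < k) \int[mu i]_x (psi t t' x * (s i x)%:E).

Section Selection.
Variables (pen : ktuple R X -> \bar R)
  (nu : forall i, {measure set (X i) -> \bar R}).

Definition pen_crit (r t : ktuple R X) : \bar R :=
  rho nu r t - (2^-1)%:E * \sum_(i < k) \int[mu i]_x (t i x)%:E - pen t.

Definition Tstat (t t' : ktuple R X) : \bar R :=
  let r : ktuple R X := fun i x => ((t i x + t' i x) / 2)%R in
  pen_crit r t' - pen_crit r t.

Definition calE (S : set (ktuple R X)) (t : ktuple R X) : set (ktuple R X) :=
  [set t' | [/\ S t', t' <> t & 0 <= Tstat t t']].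

Definition calD (S : set (ktuple R X)) (t : ktuple R X) : \bar R :=
  if `[< calE S t = set0 >] then 0
  else ereal_sup [set hell2 t t' | t' in calE S t].

Definition is_selected (Lam : Type) (Lambda : set Lam)
    (f : Lam -> ktuple R X) (tau : R) (l0 : Lam) : Prop :=
  Lambda l0 /\ forall l, Lambda l ->
    calD (f @` Lambda) (f l0) <= calD (f @` Lambda) (f l) + tau%:E.

End Selection.
End Hellinger.

Section RandomMeasures.
Context {R : realType} {dO : measure_display} {Omega : measurableType dO}.
Variable P : probability Omega R.

(* A random measure is a kernel: N w is a measure, and N w A is measurable
   in w for every measurable A. *)
Definition rm_sigma {d : measure_display} {X : measurableType d}
    (N : R.-ker Omega ~> X) : set (set Omega) :=
  <<s [set (fun w => N w A) @^-1` B |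
         A in d.-measurable & B in [set B : set (\bar R) | measurable B]] >>.

Context {k : nat} {d : 'I_k -> measure_display}
  {X : forall i, measurableType (d i)}.
Variable N : forall i, R.-ker Omega ~> X i.

Definition indep_random_measures : Prop :=
  forall (J : {set 'I_k}) (E : 'I_k -> set Omega),
    (forall i, i \in J -> rm_sigma (N i) (E i)) ->
    P (\bigcap_(i in [set` J]) E i) = \prod_(i in J) P (E i).

Definition has_intensity (mu : forall i, {measure set (X i) -> \bar R})
    (s : ktuple R X) : Prop :=
  forall i (A : set (X i)), measurable A ->
    \int[P]_w N i w A = \int[mu i]_(x in A) (s i x)%:E /\
    \int[mu i]_(x in A) (s i x)%:E < +oo.

End RandomMeasures.

(* Main.v *)
Require Import Defs.
From HB Require Import structures.
From mathcomp Require Import all_boot all_order all_algebra.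
From mathcomp Require Import all_classical all_reals all_analysis.
From mathcomp Require Import measurable_realfun ring lra.

Set Implicit Arguments.
Unset Strict Implicit.
Unset Printing Implicit Defensive.

Import Order.TTheory GRing.Theory Num.Theory.
Import numFieldNormedType.Exports.

Local Open Scope classical_set_scope.
Local Open Scope ring_scope.
Local Open Scope ereal_scope.

(** A competitor u beats t when the test statistic between them is nonnegative.
    That statistic is the centred process Zproc at (t, u) plus a deterministic
    part, and a pointwise computation ([pointwise_test], integrated in
    [Tstat_le_Zproc]) bounds the deterministic part by
    (1 + 1/sqrt 2) H2(s,t) - (1 - 1/sqrt 2) H2(s,u) + pen t - pen u,
    where H2 is the squared Hellinger distance. As z < 1 - 1/sqrt 2, a competitor
    that beats t although H2(s,u) exceeds a multiple of H2(s,t) + pen t forces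
    Zproc to exceed z H2(s,u) + pen u ([beaten_by_near_or_excess]).

    Such an event is rare. Sort the competitors of a model m into shells
    n <= H2(s,u) / tau < n + 1. The factor 4 eta^2 + Delta in the penalty and the
    value of tau turn the deviation hypothesis into a probability at most
    b exp(-4 level), with level = n + 2 eta^2 + Delta / 2 ([prob_exceed]), and the
    entropy hypothesis bounds the number of competitors in the shell by
    M exp((n + 1) / 2 + 2 eta^2). The product, weighted by the squared distance
    tau (n + 1), is summable in n and then, thanks to exp(-Delta), in m
    ([prob_bad], [expected_excess]). Hence the squared distance from s to any
    competitor beating t is at most a constant plus a random excess whose mean is
    at most tau b M Sigma; bounding the supremum by this sum of weighted
    indicators replaces an integration of tail probabilities.

    Of two competitors one always beats the other, so the selected point lies
    within the radius calD of t, up to tau ([selection_bound]). Taking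
    expectations gives the risk bound for each t ([oracle_bound]). The selected
    index is an arbitrary function of the sample point, and the random measures
    are finite only almost surely; [ge0_ae_le_integralT] deals with both. The theorem follows by passing
    to infima, and its second part because a net point lies within
    eta sqrt tau of each point of the approximated set. *)

(** * Pointwise inequalities *)

Definition midpoint (R : realType) (x y : R) : R := ((x + y) / 2)%R.

(** The value of psi at a point where the densities are x and y ([rpsiE]),
    written as half the difference of the factors sqrt (y / r) and sqrt (x / r)
    that occur in rho at the midpoint r ([sqrt_ratioB]). At x = y = 0 both
    expressions vanish, psi as 1 - 1 and this one as 0 / 0. *)
Definition rpsi (R : realType) (x y : R) : R :=
  ((Num.sqrt y - Num.sqrt x) / (2 * Num.sqrt (midpoint x y)))%R.

Section Pointwise.
Context {R : realType}.
Implicit Types x y u : R.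
Local Open Scope ring_scope.

Lemma midpoint_ge0 x y : 0 <= x -> 0 <= y -> 0 <= midpoint x y.
Proof. by rewrite /midpoint; lra. Qed.

Lemma midpointC x y : midpoint x y = midpoint y x.
Proof. by rewrite /midpoint addrC. Qed.

Lemma midpoint0 x y : 0 <= x -> 0 <= y -> midpoint x y = 0 -> x = 0 /\ y = 0.
Proof. by rewrite /midpoint; split; lra. Qed.

Let mid_sqr x y : 0 <= x -> 0 <= y ->
  2 * Num.sqrt (midpoint x y) ^+ 2 = Num.sqrt x ^+ 2 + Num.sqrt y ^+ 2.
Proof.
by move=> x0 y0; rewrite !sqr_sqrtr// /midpoint ?divr_ge0 ?addr_ge0//; lra.
Qed.

Lemma sqrte_div_midpoint x y : 0 <= x -> 0 <= y ->
  (sqrte (y%:E / (midpoint x y)%:E) =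
   (Num.sqrt y / Num.sqrt (midpoint x y))%:E)%E.
Proof.
move=> x0 y0; have [r0|rN0] := eqVneq (midpoint x y) 0.
  have [_ ->] := midpoint0 x0 y0 r0.
  by rewrite mul0e sqrte0 sqrtr0 mul0r.
rewrite inver (negbTE rN0) -EFinM/=.
by rewrite sqrtrM// sqrtrV ?midpoint_ge0.
Qed.

Lemma sqrt_ratioB x y :
  Num.sqrt y / Num.sqrt (midpoint x y) - Num.sqrt x / Num.sqrt (midpoint x y) =
  2 * rpsi x y.
Proof.
rewrite /rpsi invfM -mulrBl; move: (Num.sqrt _)^-1 => v.
by field.
Qed.

Let sqrte_half x y : 0 <= x -> 0 < y ->
  (sqrte (1 / (1 + x%:E / y%:E)) = (Num.sqrt y / Num.sqrt (x + y))%:E)%E.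
Proof.
move=> x0 y0; rewrite inver gt_eqF// -EFinM -EFinD inver.
have -> : 1 + x / y = (x + y) / y by field; lra.
rewrite mulf_eq0 invr_eq0 !gt_eqF ?ltr_wpDl//= mul1r invf_div.
by rewrite sqrtrM ?sqrtrV ?ltW// ltr_wpDl.
Qed.

Let sqrte_half0 x : 0 < x -> (sqrte (1 / (1 + x%:E / 0%:E)) = 0 :> \bar R)%E.
Proof.
move=> x0; rewrite div1e (_ : (x%:E / 0%:E = +oo)%E); last first.
  by rewrite inver eqxx mulry gtr0_sg// mul1e.
by rewrite addey// invey sqrte0.
Qed.

Let sqrt_mid x y : 0 <= x -> 0 <= y ->
  Num.sqrt 2 * Num.sqrt (midpoint x y) = Num.sqrt (x + y).
Proof.
by move=> x0 y0; rewrite -sqrtrM// /midpoint; congr Num.sqrt; field.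
Qed.

Let rpsi_sum x y : 0 <= x -> 0 <= y ->
  rpsi x y = (Num.sqrt 2)^-1 * ((Num.sqrt y - Num.sqrt x) / Num.sqrt (x + y)).
Proof.
move=> x0 y0; rewrite -sqrt_mid// /rpsi !invfM.
have -> : (2 : R)^-1 = (Num.sqrt 2)^-1 * (Num.sqrt 2)^-1.
  by rewrite -invfM -expr2 sqr_sqrtr.
by ring.
Qed.

Lemma rpsiE x y : 0 <= x -> 0 <= y ->
  (((Num.sqrt 2)^-1)%:E * (sqrte (1 / (1 + x%:E / y%:E)) -
    sqrte (1 / (1 + y%:E / x%:E))) = (rpsi x y)%:E)%E.
Proof.
move=> x0 y0; rewrite rpsi_sum//; move: x0 y0.
rewrite !le_eqVlt => /predU1P[<-|x0] /predU1P[<-|y0].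
- rewrite subrr mul0r mulr0 !mul0e adde0 subee ?mule0// sqrte_fin_num.
    by rewrite div1e inve1.
  by rewrite div1e inve1 lee01.
- rewrite (sqrte_half0 y0) (sqrte_half (lexx 0))// add0r sube0 -EFinM.
  by rewrite sqrtr0 !subr0.
- rewrite (sqrte_half0 x0) (sqrte_half (lexx 0))// add0r addr0 -EFinN -EFinM.
  by rewrite sqrtr0 !sub0r add0r mulNr.
- by rewrite !sqrte_half ?ltW// -EFinB -EFinM (addrC y x) -mulrBl.
Qed.

Lemma sqrt_ratio_le x y : 0 <= x -> 0 <= y ->
  0 <= Num.sqrt y / Num.sqrt (midpoint x y) <= 2.
Proof.
move=> x0 y0; rewrite divr_ge0//=.
have [r0|rN0] := eqVneq (midpoint x y) 0; first by rewrite r0 sqrtr0 invr0 mulr0.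
have m0 : 0 < Num.sqrt (midpoint x y) by rewrite sqrtr_gt0 lt0r rN0 midpoint_ge0.
rewrite ler_pdivrMr//.
have := mid_sqr x0 y0; have := sqrtr_ge0 x; have := sqrtr_ge0 y.
by nra.
Qed.

Lemma rpsi_norm_le1 x y : 0 <= x -> 0 <= y -> `|rpsi x y| <= 1.
Proof.
move=> x0 y0; rewrite ler_norml.
have /andP[a1 a2] := sqrt_ratio_le x0 y0.
have /andP[b1 b2] := sqrt_ratio_le y0 x0.
have := sqrt_ratioB x y; rewrite (midpointC y x) in b1 b2.
by lra.
Qed.

(** The key deterministic inequality. Writing rho for the square root of
    (x + y) / 2, one has rho / 2 + u / (2 rho) = sqrt u + (sqrt u - rho)^2 / (2 rho),
    the term sqrt u produces the difference of the two squared distances, and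
    the excess is controlled because sqrt y - sqrt x <= sqrt 2 * rho and
    because the square root is concave. *)
Lemma pointwise_test x y u : 0 <= x -> 0 <= y -> 0 <= u ->
  2^-1 * (Num.sqrt (y * midpoint x y) - Num.sqrt (x * midpoint x y))
    + rpsi x y * u - 2^-1 * (y - x) <=
  (1 + 1 / Num.sqrt 2) * (2^-1 * (Num.sqrt u - Num.sqrt x) ^+ 2)
  - (1 - 1 / Num.sqrt 2) * (2^-1 * (Num.sqrt u - Num.sqrt y) ^+ 2).
Proof.
move=> x0 y0 u0; rewrite (sqrtrM _ y0) (sqrtrM _ x0).
set q := 1 / Num.sqrt 2.
have q0 : 0 < q by rewrite divr_gt0// sqrtr_gt0.
have q2 : 2 * q ^+ 2 = 1.
  by rewrite /q expr_div_n expr1n sqr_sqrtr//; field.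
move: q q0 q2 => q q0 q2; have := mid_sqr x0 y0.
have := sqr_sqrtr x0; have := sqr_sqrtr y0; have := sqr_sqrtr u0.
have := sqrtr_ge0 x; have := sqrtr_ge0 y; have := sqrtr_ge0 u.
rewrite /rpsi; move: (Num.sqrt (midpoint x y)) (sqrtr_ge0 (midpoint x y)).
move: (Num.sqrt x) (Num.sqrt y) (Num.sqrt u) => X Y U r r0 U0 Y0 X0 <- <- <- rE.
have [r0E|rN0] := eqVneq r 0.
  have [-> ->] : X = 0 /\ Y = 0 by rewrite r0E in rE; split; nra.
  by have U2 := sqr_ge0 U; rewrite r0E; nra.
have {r0} rp : 0 < r by rewrite lt0r rN0.
have Yr : q * Y <= r by nra.
have YX : q * (Y - X) / r <= 1 by rewrite ler_pdivrMr//; nra.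
have conc : (U - r) ^+ 2 <= 2^-1 * ((U - X) ^+ 2 + (U - Y) ^+ 2).
  have XYr : X + Y <= 2 * r.
    rewrite -ler_sqr ?nnegrE ?addr_ge0 ?mulr_ge0 ?(ltW rp)//.
    by have := sqr_ge0 (X - Y); nra.
  have : U * (X + Y) <= U * (2 * r) by rewrite ler_wpM2l.
  by nra.
have main : (Y - X) / r * (U - r) ^+ 2 <= q * ((U - X) ^+ 2 + (U - Y) ^+ 2).
  have : (Y - X) / r <= 2 * q.
    (* 2 q^2 = 1 turns q w <= 1 into w <= 2 q *)
    move: YX; rewrite -mulrA; move: ((Y - X) / r) => w qw1.
    have : 2 * q ^+ 2 * w = w by rewrite q2 mul1r.
    by nra.
  have := sqr_ge0 (U - r).
  by move=> h1 h2; nra.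
have -> : 2^-1 * (Y * r - X * r) + (Y - X) / (2 * r) * U ^+ 2
    - 2^-1 * (Y ^+ 2 - X ^+ 2) =
  2^-1 * (U - X) ^+ 2 - 2^-1 * (U - Y) ^+ 2
    + 2^-1 * ((Y - X) / r * (U - r) ^+ 2) by field.
by nra.
Qed.

Lemma sqr_distD x y u :
  (x - y) ^+ 2 <= 2 * (u - x) ^+ 2 + 2 * (u - y) ^+ 2.
Proof. by have := sqr_ge0 (x + y - 2 * u); nra. Qed.

Lemma sqr_sqrtB_le x y : 0 <= x -> 0 <= y ->
  (Num.sqrt x - Num.sqrt y) ^+ 2 <= x + y.
Proof.
move=> x0 y0; rewrite -[in leRHS](sqr_sqrtr x0) -[in leRHS](sqr_sqrtr y0).
by have := sqrtr_ge0 x; have := sqrtr_ge0 y; nra.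
Qed.

Lemma sqrtM_midpoint_le x y : 0 <= x -> 0 <= y ->
  Num.sqrt (y * midpoint x y) <= x + y.
Proof.
move=> x0 y0; rewrite -[leRHS]ger0_norm ?addr_ge0// -sqrtr_sqr.
by rewrite ler_wsqrtr// /midpoint; nra.
Qed.

End Pointwise.

(** * Integrability and componentwise integrals *)

Section RealIntegrals.
Context {R : realType} {d : measure_display} {T : measurableType d}.
Implicit Types (m n : {measure set T -> \bar R}) (f g t : T -> R).

Definition density m t : Prop :=
  (forall x, (0 <= t x)%R) /\ m.-integrable [set: T] (EFin \o t).

Lemma measurable_density m t : density m t -> measurable_fun [set: T] t.
Proof. by case=> _ /measurable_int /measurable_EFinP. Qed.

Lemma measurable_sqrt f : measurable_fun [set: T] f ->
  measurable_fun [set: T] (fun x => Num.sqrt (f x)).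
Proof.
apply: measurableT_comp; apply: continuous_measurable_fun.
exact: sqrt_continuous.
Qed.

(** Inversion is measurable as a power function, and 0 is sent to 0 on both
    sides. *)
Lemma measurable_sqrtV f : measurable_fun [set: T] f ->
  measurable_fun [set: T] (fun x => (Num.sqrt (f x))^-1)%R.
Proof.
move=> mf; under eq_fun do rewrite -powR_inv1 ?sqrtr_ge0//.
by apply: (measurableT_comp (measurable_powR _)); exact: measurable_sqrt.
Qed.

Lemma measurable_midpoint f g :
  measurable_fun [set: T] f -> measurable_fun [set: T] g ->
  measurable_fun [set: T] (fun x => midpoint (f x) (g x)).
Proof.
move=> mf mg; apply: measurable_funM; last exact: measurable_cst.
exact: measurable_funD.
Qed.

Lemma measurable_sqrt_ratio f g :
  measurable_fun [set: T] f -> measurable_fun [set: T] g ->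
  measurable_fun [set: T]
    (fun x => Num.sqrt (g x) / Num.sqrt (midpoint (f x) (g x)))%R.
Proof.
move=> mf mg; apply: measurable_funM; first exact: measurable_sqrt.
by apply: measurable_sqrtV; exact: measurable_midpoint.
Qed.

Lemma measurable_rpsi f g :
  measurable_fun [set: T] f -> measurable_fun [set: T] g ->
  measurable_fun [set: T] (fun x => rpsi (f x) (g x)).
Proof.
move=> mf mg; rewrite /rpsi; under eq_fun do rewrite invfM.
apply: measurable_funM.
  by apply: measurable_funB; exact: measurable_sqrt.
apply: measurable_funM; first exact: measurable_cst.
by apply: measurable_sqrtV; exact: measurable_midpoint.
Qed.

Lemma integrable_dominated m f g : measurable_fun [set: T] f ->
  (forall x, `|f x| <= g x)%R -> m.-integrable [set: T] (EFin \o g) ->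
  m.-integrable [set: T] (EFin \o f).
Proof.
move=> mf fg; apply: le_integrable => //; first exact/measurable_EFinP.
by move=> x _ /=; rewrite lee_fin (le_trans (fg x))// ler_norm.
Qed.

Lemma integrable_bounded m f (c : R) : m [set: T] < +oo ->
  measurable_fun [set: T] f -> (forall x, `|f x| <= c)%R ->
  m.-integrable [set: T] (EFin \o f).
Proof.
move=> moo mf fc; apply: measurable_bounded_integrable => //.
exists c; split; first exact: num_real.
by move=> y cy x _ /=; rewrite (le_trans (fc x))// ltW.
Qed.

Lemma integrableDr m f g : m.-integrable [set: T] (EFin \o f) ->
  m.-integrable [set: T] (EFin \o g) ->
  m.-integrable [set: T] (EFin \o (fun x => f x + g x)%R).
Proof. by move=> mf mg; exact: (integrableD _ mf mg). Qed.

Lemma integrableBr m f g : m.-integrable [set: T] (EFin \o f) ->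
  m.-integrable [set: T] (EFin \o g) ->
  m.-integrable [set: T] (EFin \o (fun x => f x - g x)%R).
Proof. by move=> mf mg; exact: (integrableB _ mf mg). Qed.

Lemma integrableZlr m f (c : R) : m.-integrable [set: T] (EFin \o f) ->
  m.-integrable [set: T] (EFin \o (fun x => c * f x)%R).
Proof. by move=> mf; exact: (integrableZl _ c mf). Qed.

Lemma integrable_sqr_sqrtB m f g : density m f -> density m g ->
  m.-integrable [set: T]
    (EFin \o (fun x => (Num.sqrt (f x) - Num.sqrt (g x)) ^+ 2)%R).
Proof.
move=> df dg; have [[f0 fi] [g0 gi]] := (df, dg);
  have [mf mg] := (measurable_density df, measurable_density dg).
apply: (integrable_dominated _ _ (integrableDr fi gi)).
  apply: measurable_funX; apply: measurable_funB; apply: measurable_sqrt;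
    assumption.
by move=> x; rewrite ger0_norm ?sqr_ge0// sqr_sqrtB_le.
Qed.

Lemma integrable_sqrtM_midpoint m f g : density m f -> density m g ->
  m.-integrable [set: T]
    (EFin \o (fun x => Num.sqrt (g x * midpoint (f x) (g x)))%R).
Proof.
move=> df dg; have [[f0 fi] [g0 gi]] := (df, dg);
  have [mf mg] := (measurable_density df, measurable_density dg).
apply: (integrable_dominated _ _ (integrableDr fi gi)).
  apply: measurable_sqrt; apply: measurable_funM.
    exact: mg.
  exact: measurable_midpoint.
by move=> x; rewrite ger0_norm ?sqrtr_ge0// sqrtM_midpoint_le.
Qed.

Lemma integrable_rpsiM m f g s : density m f -> density m g -> density m s ->
  m.-integrable [set: T] (EFin \o (fun x => rpsi (f x) (g x) * s x)%R).
Proof.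
move=> df dg ds; have [[f0 fi] [g0 gi]] := (df, dg);
  have [mf mg] := (measurable_density df, measurable_density dg).
have [[s0 si] ms] := (ds, measurable_density ds).
apply: (integrable_dominated _ _ si).
  apply: measurable_funM; last exact: ms.
  exact: measurable_rpsi.
by move=> x; rewrite normrM (ger0_norm (s0 x)) ler_piMl// rpsi_norm_le1.
Qed.

Lemma integrable_rpsi m n f g : density m f -> density m g ->
  n [set: T] < +oo ->
  n.-integrable [set: T] (EFin \o (fun x => rpsi (f x) (g x))).
Proof.
move=> df dg noo; have [[f0 fi] [g0 gi]] := (df, dg);
  have [mf mg] := (measurable_density df, measurable_density dg).
apply: (@integrable_bounded _ _ 1%R) => //.
  exact: measurable_rpsi.
by move=> x; rewrite rpsi_norm_le1.
Qed.

Lemma integrable_sqrt_ratio m n f g : density m f -> density m g ->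
  n [set: T] < +oo ->
  n.-integrable [set: T]
    (EFin \o (fun x => Num.sqrt (g x) / Num.sqrt (midpoint (f x) (g x)))%R).
Proof.
move=> df dg noo; have [[f0 fi] [g0 gi]] := (df, dg);
  have [mf mg] := (measurable_density df, measurable_density dg).
apply: (@integrable_bounded _ _ 2%R) => //.
  exact: measurable_sqrt_ratio.
move=> x; have /andP[h0 h2] := sqrt_ratio_le (f0 x) (g0 x); by rewrite ger0_norm.
Qed.

End RealIntegrals.

Section ComponentwiseIntegral.
Context {R : realType} {k : nat} {d : 'I_k -> measure_display}
  {X : forall i, measurableType (d i)}.
Implicit Types (nu : forall i, {measure set (X i) -> \bar R}) (f g : ktuple R X).

Definition kintegrable nu f : Prop :=
  forall i, (nu i).-integrable [set: X i] (EFin \o f i).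

Definition kint nu f : R := (\sum_(i < k) \int[nu i]_x f i x)%R.

Lemma kint_EFin nu f : kintegrable nu f ->
  \sum_(i < k) \int[nu i]_x (f i x)%:E = (kint nu f)%:E.
Proof.
move=> fi; rewrite /kint -sumEFin; apply: eq_bigr => i _.
by rewrite fineK//; exact: integrable_fin_num (fi i).
Qed.

Lemma kintegrableB nu f g : kintegrable nu f -> kintegrable nu g ->
  kintegrable nu (fun i x => f i x - g i x)%R.
Proof. by move=> fi gi i; exact: integrableBr. Qed.

Lemma kintegrableD nu f g : kintegrable nu f -> kintegrable nu g ->
  kintegrable nu (fun i x => f i x + g i x)%R.
Proof. by move=> fi gi i; exact: integrableDr. Qed.

Lemma kintegrableZ nu c f : kintegrable nu f ->
  kintegrable nu (fun i x => c * f i x)%R.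
Proof. by move=> fi i; exact: integrableZlr. Qed.

Lemma kintB nu f g : kintegrable nu f -> kintegrable nu g ->
  kint nu (fun i x => f i x - g i x)%R = (kint nu f - kint nu g)%R.
Proof.
move=> fi gi; rewrite /kint -sumrB; apply: eq_bigr => i _.
by rewrite RintegralB.
Qed.

Lemma kintD nu f g : kintegrable nu f -> kintegrable nu g ->
  kint nu (fun i x => f i x + g i x)%R = (kint nu f + kint nu g)%R.
Proof.
move=> fi gi; rewrite /kint -big_split; apply: eq_bigr => i _.
by rewrite RintegralD.
Qed.

Lemma kintZ nu c f : kintegrable nu f ->
  kint nu (fun i x => c * f i x)%R = (c * kint nu f)%R.
Proof.
move=> fi; rewrite /kint mulr_sumr; apply: eq_bigr => i _.
by rewrite RintegralZl.
Qed.

Lemma le_kint nu f g : kintegrable nu f -> kintegrable nu g ->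
  (forall i x, f i x <= g i x)%R -> (kint nu f <= kint nu g)%R.
Proof.
move=> fi gi fg; apply: ler_sum => i _.
by apply: le_Rintegral => // x _; exact: fg.
Qed.

End ComponentwiseIntegral.

(** * Hellinger distance and the test statistic as real numbers *)

Section HellingerReal.
Context {R : realType} {k : nat} {d : 'I_k -> measure_display}
  {X : forall i, measurableType (d i)}.
Variable mu : forall i, {measure set (X i) -> \bar R}.
Implicit Types (t s u : ktuple R X) (p q : R).

Definition sqr_sqrt_dist t u : ktuple R X :=
  fun i x => ((Num.sqrt (t i x) - Num.sqrt (u i x)) ^+ 2)%R.

Definition hellr2 t u : R := (2^-1 * kint mu (sqr_sqrt_dist t u))%R.

Lemma kintegrable_sqr_sqrt_dist t u : calL mu t -> calL mu u ->
  kintegrable mu (sqr_sqrt_dist t u).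
Proof. by move=> tL uL i; exact: (integrable_sqr_sqrtB (tL i) (uL i)). Qed.

Lemma hell2E t u : calL mu t -> calL mu u -> hell2 mu t u = (hellr2 t u)%:E.
Proof.
move=> tL uL; rewrite /hell2 /hellr2 EFinM; congr (_ * _).
by rewrite -kint_EFin//; exact: kintegrable_sqr_sqrt_dist.
Qed.

Lemma hellr2_ge0 t u : (0 <= hellr2 t u)%R.
Proof.
rewrite mulr_ge0// sumr_ge0// => i _; apply: Rintegral_ge0 => x _.
exact: sqr_ge0.
Qed.

Lemma hellE t u : calL mu t -> calL mu u ->
  hell mu t u = (Num.sqrt (hellr2 t u))%:E.
Proof. by move=> tL uL; rewrite /hell hell2E. Qed.

Lemma hell_sqr t u : calL mu t -> calL mu u -> hell mu t u ^+ 2 = (hellr2 t u)%:E.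
Proof. by move=> tL uL; rewrite /hell hell2E// sqr_sqrte// lee_fin hellr2_ge0. Qed.

Lemma le_hell t u (y : R) : calL mu t -> calL mu u -> (0 <= y)%R ->
  (hell mu t u <= y%:E) = (hellr2 t u <= y ^+ 2)%R.
Proof.
move=> tL uL y0; rewrite hellE// lee_fin -[in LHS](ger0_norm y0) -sqrtr_sqr.
by rewrite ler_sqrt// sqr_ge0.
Qed.

Lemma hellr2C t u : hellr2 t u = hellr2 u t.
Proof.
rewrite /hellr2; congr (_ * kint _ _)%R.
by apply: functional_extensionality_dep => i; apply/funext => x;
  rewrite /sqr_sqrt_dist -sqrrN opprB.
Qed.

(** Integration of (x - y)^2 <= 2 (u - x)^2 + 2 (u - y)^2; the factor 2 is the
    cost of working with squared distances throughout. *)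
Lemma hellr2_triangle s t u : calL mu s -> calL mu t -> calL mu u ->
  (hellr2 t u <= 2 * hellr2 s t + 2 * hellr2 s u)%R.
Proof.
move=> sL tL uL.
have ist := kintegrable_sqr_sqrt_dist sL tL.
have isu := kintegrable_sqr_sqrt_dist sL uL.
rewrite /hellr2 ![(2 * (_ * _))%R]mulrCA -mulrDr ler_pM2l//.
rewrite -!kintZ// -kintD; [|exact: kintegrableZ..].
apply: le_kint => [||i x]; last exact: sqr_distD.
  exact: kintegrable_sqr_sqrt_dist.
by apply: kintegrableD; exact: kintegrableZ.
Qed.

Definition ktuple_mid t u : ktuple R X := fun i x => ((t i x + u i x) / 2)%R.

Section FixedMeasures.
Variables (pen : ktuple R X -> \bar R)
  (nu : forall i, {measure set (X i) -> \bar R}).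
Hypothesis nu_fin : forall i, nu i [set: X i] < +oo.

Let critr t u : R :=
  (2^-1 * (kint mu (fun i x => Num.sqrt (u i x * midpoint (t i x) (u i x)))
     + kint nu (fun i x => Num.sqrt (u i x) / Num.sqrt (midpoint (t i x) (u i x))))
   - 2^-1 * kint mu u)%R.

Let pen_critE t u : calL mu t -> calL mu u ->
  pen_crit mu pen nu (ktuple_mid t u) u = (critr t u)%:E - pen u.
Proof.
move=> tL uL.
have [t0 u0] : (forall i x, 0 <= t i x)%R /\ (forall i x, 0 <= u i x)%R.
  by split => i; [case: (tL i) | case: (uL i)].
rewrite /pen_crit /rho /critr EFinB !EFinM EFinD.
rewrite -!kint_EFin; first last.
- by move=> i; exact: (integrable_sqrtM_midpoint (tL i) (uL i)).
- by move=> i; apply: (integrable_sqrt_ratio (tL i) (uL i)).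
- by move=> i; case: (uL i).
congr (_ - _); congr (_ - _); congr (_ * (_ + _)).
by apply: eq_bigr => i _; apply: eq_integral => x _; exact: sqrte_div_midpoint.
Qed.

Let TstatE t u p q : calL mu t -> calL mu u ->
  pen t = p%:E -> pen u = q%:E ->
  Tstat mu pen nu t u = ((critr t u - q) - (critr u t - p))%:E.
Proof.
move=> tL uL pt pu; rewrite /Tstat -/(ktuple_mid t u) pen_critE//.
have -> : ktuple_mid t u = ktuple_mid u t.
  apply: functional_extensionality_dep => i; apply/funext => x.
  by rewrite /ktuple_mid addrC.
by rewrite pen_critE// pt pu.
Qed.

Lemma Tstat_total t u p q : calL mu t -> calL mu u ->
  pen t = p%:E -> pen u = q%:E ->
  0 <= Tstat mu pen nu t u \/ 0 <= Tstat mu pen nu u t.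
Proof.
move=> tL uL pt pu; rewrite (TstatE tL uL pt pu) (TstatE uL tL pu pt) !lee_fin.
by have [] := lerP 0 ((critr t u - q) - (critr u t - p))%R; [left | right; lra].
Qed.

Let ZprocE s t u : calL mu s -> calL mu t -> calL mu u ->
  Zproc mu s nu t u = (kint nu (fun i x => rpsi (t i x) (u i x)) -
    kint mu (fun i x => rpsi (t i x) (u i x) * s i x)%R)%:E.
Proof.
move=> sL tL uL; rewrite /Zproc EFinB -!kint_EFin; first last.
- by move=> i; apply: (integrable_rpsi (tL i) (uL i)).
- by move=> i; exact: (integrable_rpsiM (tL i) (uL i) (sL i)).
have psiE i x : psi t u x = (rpsi (t i x) (u i x))%:E.
  by apply: rpsiE; [case: (tL i) | case: (uL i)].
by congr (_ - _); apply: eq_bigr => i _; apply: eq_integral => x _; rewrite psiE.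
Qed.

(** The integrals of the ratios against nu differ by twice the integral of psi
    against nu, which is the random part of Zproc. What remains is an integral
    against mu, estimated pointwise by [pointwise_test]. *)
Lemma Tstat_le_Zproc s t u p q : calL mu s -> calL mu t -> calL mu u ->
  pen t = p%:E -> pen u = q%:E -> 0 <= Tstat mu pen nu t u ->
  ((1 - 1 / Num.sqrt 2) * hellr2 s u - (1 + 1 / Num.sqrt 2) * hellr2 s t
     + q - p)%:E <= Zproc mu s nu t u.
Proof.
move=> sL tL uL pt pu; rewrite (TstatE tL uL pt pu) ZprocE// !lee_fin /critr /hellr2.
have it := kintegrable_sqr_sqrt_dist sL tL.
have iu := kintegrable_sqr_sqrt_dist sL uL.
have isq1 : kintegrable mu (fun i x => Num.sqrt (u i x * midpoint (t i x) (u i x))).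
  by move=> i; exact: (integrable_sqrtM_midpoint (tL i) (uL i)).
have isq2 : kintegrable mu (fun i x => Num.sqrt (t i x * midpoint (u i x) (t i x))).
  by move=> i; exact: (integrable_sqrtM_midpoint (uL i) (tL i)).
have ir1 : kintegrable nu
    (fun i x => Num.sqrt (u i x) / Num.sqrt (midpoint (t i x) (u i x)))%R.
  by move=> i; apply: (integrable_sqrt_ratio (tL i) (uL i)).
have ir2 : kintegrable nu
    (fun i x => Num.sqrt (t i x) / Num.sqrt (midpoint (u i x) (t i x)))%R.
  by move=> i; apply: (integrable_sqrt_ratio (uL i) (tL i)).
have ip : kintegrable mu (fun i x => rpsi (t i x) (u i x) * s i x)%R.
  by move=> i; exact: (integrable_rpsiM (tL i) (uL i) (sL i)).
have ip' : kintegrable nu (fun i x => rpsi (t i x) (u i x)).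
  by move=> i; apply: (integrable_rpsi (tL i) (uL i)).
have tI : kintegrable mu t by move=> i; case: (tL i).
have uI : kintegrable mu u by move=> i; case: (uL i).
have nuE : (kint nu
     (fun i x => Num.sqrt (u i x) / Num.sqrt (midpoint (t i x) (u i x)))
   - kint nu (fun i x => Num.sqrt (t i x) / Num.sqrt (midpoint (u i x) (t i x)))
   = 2 * kint nu (fun i x => rpsi (t i x) (u i x)))%R.
  rewrite -kintB// -kintZ//; congr (kint _ _).
  apply: functional_extensionality_dep => i; apply/funext => x.
  by rewrite (midpointC (u i x)) sqrt_ratioB.
set c1 := (1 - 1 / Num.sqrt 2 : R)%R; set c2 := (1 + 1 / Num.sqrt 2 : R)%R.
have muLE : (2^-1 * (kint mu (fun i x => Num.sqrt (u i x * midpoint (t i x) (u i x)))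
     - kint mu (fun i x => Num.sqrt (t i x * midpoint (u i x) (t i x))))
   + kint mu (fun i x => rpsi (t i x) (u i x) * s i x)
   - 2^-1 * (kint mu u - kint mu t)
   <= c2 * (2^-1 * kint mu (sqr_sqrt_dist s t))
    - c1 * (2^-1 * kint mu (sqr_sqrt_dist s u)))%R.
  rewrite -!kintB// -!kintZ//; [|by apply: kintegrableZ|by apply: kintegrableZ
    |by apply: kintegrableB|by apply: kintegrableB].
  rewrite -kintD//; last by apply: kintegrableZ; exact: kintegrableB.
  have iA : kintegrable mu (fun i x => 2^-1 *
      (Num.sqrt (u i x * midpoint (t i x) (u i x)) -
       Num.sqrt (t i x * midpoint (u i x) (t i x))) +
      rpsi (t i x) (u i x) * s i x)%R.
    by apply: kintegrableD => //; apply: kintegrableZ; exact: kintegrableB.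
  have iB : kintegrable mu (fun i x => 2^-1 * (u i x - t i x))%R.
    by apply: kintegrableZ; exact: kintegrableB.
  have iC : kintegrable mu (fun i x => c2 * (2^-1 * sqr_sqrt_dist s t x))%R.
    by do 2 apply: kintegrableZ.
  have iD : kintegrable mu (fun i x => c1 * (2^-1 * sqr_sqrt_dist s u x))%R.
    by do 2 apply: kintegrableZ.
  rewrite -!kintB//; apply: le_kint; [exact: kintegrableB..|].
  move=> i x; rewrite (midpointC (u i x)).
  by apply: pointwise_test; [case: (tL i) | case: (uL i) | case: (sL i)].
by move: nuE muLE; lra.
Qed.

End FixedMeasures.
End HellingerReal.

(** * Expectations of possibly non-measurable bounds *)

Section Expectation.
Context {R : realType} {dO : measure_display} {Omega : measurableType dO}.
Variable P : probability Omega R.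
Implicit Types (F G : Omega -> \bar R).

(** The integral of a nonnegative function is a supremum over simple functions
    below it, hence monotone on arbitrary nonnegative functions; this is what
    lets the selected index be an arbitrary function on Omega. *)
Lemma ge0_le_integralT F G : (forall w, 0 <= F w) ->
  (forall w, F w <= G w) -> \int[P]_w F w <= \int[P]_w G w.
Proof.
move=> F0 FG; have G0 w : 0 <= G w by exact: le_trans (FG w).
rewrite !ge0_integralTE//; apply: ereal_sup_le => _ [h hF <-].
by exists h => // w; exact: le_trans (FG w).
Qed.

Lemma ge0_ae_le_integralT F G : (forall w, 0 <= F w) ->
  (forall w, 0 <= G w) -> measurable_fun [set: Omega] G ->
  {ae P, forall w, F w <= G w} -> \int[P]_w F w <= \int[P]_w G w.
Proof.
move=> F0 G0 mG [N0 [mN0 PN0 FG]].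
(* adding +oo on the null set N0 makes the domination hold everywhere and
   leaves the integral of G unchanged *)
have m1 : measurable_fun [set: Omega] (fun w => (\1_N0 w : R)%:E).
  by apply/measurable_EFinP; exact: measurable_indic.
have m2 : measurable_fun [set: Omega] (fun w => +oo * (\1_N0 w : R)%:E).
  exact: measurable_funeM.
have pos2 w : 0 <= +oo * (\1_N0 w : R)%:E by rewrite mule_ge0// lee_fin.
have -> : \int[P]_w G w = \int[P]_w (G w + +oo * (\1_N0 w)%:E).
  rewrite ge0_integralD// ge0_integralZl//.
    by rewrite integral_indic// setIT [X in +oo * X]PN0 mule0 adde0.
apply: ge0_le_integralT => // w.
have [N0w|N0w] := pselect (N0 w).
  by rewrite indicE mem_set//= mule1 addey ?leey// gt_eqF// (lt_le_trans _ (G0 w)).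
rewrite indicE memNset//= mule0 adde0.
by apply: contrapT => nFG; apply: N0w; exact: FG.
Qed.

(** The union bound over a finite set of a type without a chosen point: the
    events are regrouped along the fibres of an enumeration of the set. *)
Lemma measure_bigcup_card (U : Type) (B : set U) (n : nat)
    (E : U -> set Omega) (p : \bar R) : (B #= `I_n)%card ->
  (forall u, B u -> measurable (E u)) -> (forall u, B u -> P (E u) <= p) ->
  measurable (\bigcup_(u in B) E u) /\ P (\bigcup_(u in B) E u) <= n%:R%:E * p.
Proof.
move=> /pcard_eqP/unsquash g mE PE.
pose E' i := \bigcup_(u in B `&` [set u | g u = i]) E u.
have E'E i : (i < n)%N -> exists2 u, B u & E' i = E u.
  move=> ni; have [u Bu gui] := 'surj_g ni.
  exists u => //; apply/seteqP; split => w /=; last by exists u.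
  move=> [v [Bv gvi] Evw]; have -> // : u = v.
  apply: ('inj_g); rewrite ?inE//.
  by rewrite gui -gvi.
have BE : \bigcup_(u in B) E u = \big[setU/set0]_(i < n) E' i.
  rewrite -bigcup_mkord; apply/seteqP; split => w /=.
    by move=> [u Bu Euw]; exists (g u); [exact: funS | exists u].
  by move=> [i _ [u [Bu _] Euw]]; exists u.
have mE' i : (i < n)%N -> measurable (E' i).
  by move=> /E'E[u Bu ->]; exact: mE.
rewrite BE; split; first by apply: bigsetU_measurable => i _; exact: mE'.
apply: (le_trans (Boole_inequality _ mE')).
apply: (@le_trans _ _ (\sum_(i < n) p)).
  by apply: lee_sum => i _; have [u Bu ->] := E'E _ (ltn_ord i); exact: PE.
by rewrite sumr_const card_ord mule_natl.
Qed.

Lemma integral_weighted_events (c : nat -> nat -> R) (A : nat -> nat -> set Omega) :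
  (forall i j, 0 <= c i j)%R -> (forall i j, measurable (A i j)) ->
  measurable_fun [set: Omega]
    (fun w => \sum_(i <oo) \sum_(j <oo) (c i j)%:E * (\1_(A i j) w)%:E) /\
  \int[P]_w (\sum_(i <oo) \sum_(j <oo) (c i j)%:E * (\1_(A i j) w)%:E) =
    \sum_(i <oo) \sum_(j <oo) (c i j)%:E * P (A i j).
Proof.
move=> c0 mA.
have m0 i j : measurable_fun [set: Omega] (fun w => (\1_(A i j) w : R)%:E).
  by apply/measurable_EFinP; exact: measurable_indic.
have m1 i j : measurable_fun [set: Omega]
    (fun w => (c i j)%:E * (\1_(A i j) w)%:E).
  exact: measurable_funeM.
have p1 i j w : 0 <= (c i j)%:E * (\1_(A i j) w)%:E :> \bar R.
  by rewrite mule_ge0 ?lee_fin.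
have m2 i : measurable_fun [set: Omega]
    (fun w => \sum_(j <oo) (c i j)%:E * (\1_(A i j) w)%:E).
  by apply: ge0_emeasurable_sum => // j w _ _; exact: p1.
have p2 i w : 0 <= \sum_(j <oo) (c i j)%:E * (\1_(A i j) w)%:E :> \bar R.
  by apply: nneseries_ge0 => j _ _; exact: p1.
split; first by apply: ge0_emeasurable_sum => // i w _ _; exact: p2.
rewrite integral_nneseries//; apply: eq_eseriesr => i _.
rewrite integral_nneseries//; apply: eq_eseriesr => j _.
rewrite ge0_integralZl ?lee_fin//.
by rewrite integral_indic// setIT.
Qed.

Lemma weighted_events_ge (c : nat -> nat -> R) (A : nat -> nat -> set Omega) i j w :
  (forall i j, 0 <= c i j)%R -> A i j w ->
  (c i j)%:E <= \sum_(i <oo) \sum_(j <oo) (c i j)%:E * (\1_(A i j) w)%:E.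
Proof.
move=> c0 Aw.
have p1 i' j' : 0 <= (c i' j')%:E * (\1_(A i' j') w)%:E :> \bar R.
  by rewrite mule_ge0 ?lee_fin.
have p2 i' : 0 <= \sum_(j' <oo) (c i' j')%:E * (\1_(A i' j') w)%:E :> \bar R.
  by apply: nneseries_ge0 => j' _ _; exact: p1.
apply: (@le_trans _ _ (\sum_(j' <oo) (c i j')%:E * (\1_(A i j') w)%:E)).
  apply: le_trans (nneseries_lim_ge j.+1 _) => //.
  rewrite big_nat_recr//= indicE mem_set//= mule1 leeDr// sume_ge0//.
apply: le_trans (nneseries_lim_ge i.+1 _) => //.
by rewrite big_nat_recr//= leeDr// sume_ge0.
Qed.

End Expectation.

(** A sum over a countable type as a series over the codes of its elements, so
    that the exchange of integrals and series applies to it. *)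
Lemma nneseries_pickle (R : realType) (I : countType) (a : I -> \bar R) :
  (forall m, 0 <= a m) ->
  \sum_(i <oo) (if pickle_inv i is Some m then a m else 0) =
  \esum_(m in [set: I]) a m.
Proof.
move=> a0; rewrite nneseries_esumT; last by move=> i; case: pickle_inv.
set g := fun i : nat => _.
have -> : \esum_(i in [set: nat]) g i = \esum_(i in range (@pickle I)) g i.
  rewrite [RHS]esum_mkcond; apply: eq_esum => i _; case: ifPn => // iN.
  rewrite /g; case E: (pickle_inv i) => [m|//].
  move: iN; rewrite notin_setE => -[]; exists m => //.
  by have := @pickle_invK I i; rewrite E.
rewrite (reindex_esum [set: I] (range (@pickle I)) pickle g); last first.
  by split => [m _|m m' _ _|//]; [exists m | exact: (pcan_inj pickleK_inv)].
by apply: eq_esum => m _; rewrite /g pickleK_inv.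
Qed.

(** * Random measures *)

Section RandomMeasure.
Context {R : realType} {dO : measure_display} {Omega : measurableType dO}.
Context {k : nat} {d : 'I_k -> measure_display}
  {X : forall i, measurableType (d i)}.
Variables (P : probability Omega R) (N : forall i, R.-ker Omega ~> X i)
  (mu : forall i, {measure set (X i) -> \bar R}).
Implicit Types (s t u : ktuple R X).

Lemma measurable_kernel_integral i (g : X i -> \bar R) :
  measurable_fun [set: X i] g ->
  measurable_fun [set: Omega] (fun w => \int[N i w]_x g x).
Proof.
move=> mg; under eq_fun do rewrite integralE.
apply: emeasurable_funB.
  apply: (measurable_fun_integral_kernel (measurable_kernel (N i))) => //.
  exact: measurable_funepos.
apply: (measurable_fun_integral_kernel (measurable_kernel (N i))) => //.
exact: measurable_funeneg.
Qed.

Lemma measurable_Zproc_gt s t u (x : \bar R) : calL mu t -> calL mu u ->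
  measurable [set w | x < Zproc mu s (fun i => N i w) t u].
Proof.
move=> tL uL.
suff mZ : measurable_fun [set: Omega] (fun w => Zproc mu s (fun i => N i w) t u).
  by rewrite -[X in measurable X]setTI; exact: emeasurable_fun_o_infty.
apply: emeasurable_funB; last exact: measurable_cst.
apply: emeasurable_sum => i; apply: measurable_kernel_integral.
apply: (eq_measurable_fun (EFin \o (fun x : X i => rpsi (t i x) (u i x)))).
  move=> y _; apply/esym/rpsiE.
    by have [+ _] := tL i; apply.
  by have [+ _] := uL i; apply.
apply/measurable_EFinP.
by apply: measurable_rpsi; [exact: measurable_density (tL i)
  | exact: measurable_density (uL i)].
Qed.

Lemma ae_random_measure_finite s : has_intensity P N mu s ->
  {ae P, forall w, forall i, N i w [set: X i] < +oo}.
Proof.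
move=> hN; apply: filter_forall => i.
have mN : measurable_fun [set: Omega] (fun w => N i w [set: X i]).
  exact: measurable_kernel.
have : P.-integrable [set: Omega] (fun w => N i w [set: X i]).
  apply/integrableP; split => //.
  under eq_integral do rewrite gee0_abs//.
  by have [-> ] := hN i _ measurableT.
move=> /(integrable_ae measurableT); apply: filterS => w /(_ Logic.I).
by rewrite ge0_fin_numE.
Qed.

End RandomMeasure.

(** * The selection rule *)

Section SelectionRule.
Context {R : realType} {k : nat} {d : 'I_k -> measure_display}
  {X : forall i, measurableType (d i)}.
Variables (mu nu : forall i, {measure set (X i) -> \bar R})
  (pen : ktuple R X -> \bar R) (S : set (ktuple R X)).
Hypothesis nu_fin : forall i, nu i [set: X i] < +oo.
Hypothesis pen_fin : forall t, S t -> pen t \is a fin_num.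
Hypothesis S_calL : S `<=` calL mu.
Implicit Types (s t u : ktuple R X).

Let calD_ub t u : S t -> S u -> u <> t -> 0 <= Tstat mu pen nu t u ->
  (hellr2 mu t u)%:E <= calD mu pen nu S t.
Proof.
move=> St Su ut Ttu; rewrite /calD; case: asboolP => [E0|_].
  by have : calE mu pen nu S t u; [split | rewrite E0].
by apply: ereal_sup_ubound; exists u; [split | rewrite hell2E//; exact: S_calL].
Qed.

(** Either u beats t, and then H2(t,u) is at most calD t, or t beats u, and
    then H2(t,u) is at most calD u, which exceeds calD t by at most tau. The
    hypothesis on the competitors beating t controls calD t through s. *)
Lemma selection_bound s t u (tau b : R) : calL mu s -> S t -> S u ->
  (0 <= b)%R -> (0 <= tau)%R ->
  calD mu pen nu S u <= calD mu pen nu S t + tau%:E ->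
  (forall v, S v -> 0 <= Tstat mu pen nu t v -> (hellr2 mu s v <= b)%R) ->
  (hellr2 mu s u <= 6 * hellr2 mu s t + 4 * b + 2 * tau)%R.
Proof.
move=> sL St Su b0 tau0 Dut near.
have h0 := hellr2_ge0 mu s t.
have [tL uL] := (S_calL St, S_calL Su).
have [->|ut] := pselect (u = t); first by lra.
have Dt : calD mu pen nu S t <= (2 * hellr2 mu s t + 2 * b)%:E.
  rewrite /calD; case: asboolP => _; first by rewrite lee_fin; lra.
  apply: ge_ereal_sup => _ [v [Sv _ Tv] <-].
  have vL := S_calL Sv; rewrite hell2E// lee_fin.
  by have := hellr2_triangle sL tL vL; have := near v Sv Tv; lra.
have tu : (hellr2 mu t u)%:E <= calD mu pen nu S t + tau%:E.
  have pt := esym (fineK (pen_fin St)); have pu := esym (fineK (pen_fin Su)).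
  have [Ttu|Tut] := Tstat_total nu_fin tL uL pt pu.
    by rewrite (le_trans (calD_ub St Su ut Ttu))// leeDl// lee_fin.
  rewrite hellr2C (le_trans _ Dut)//; apply: calD_ub => //; exact: nesym.
have {tu Dt} : (hellr2 mu t u <= 2 * hellr2 mu s t + 2 * b + tau)%R.
  by rewrite -lee_fin (le_trans tu)// EFinD leeD2r.
have := hellr2_triangle (S_calL St) sL (S_calL Su).
by rewrite [hellr2 mu t s]hellr2C; lra.
Qed.

End SelectionRule.

(** * Deviation bounds and summation over the models *)

Section OracleBound.
Context {R : realType} {k : nat} {d : 'I_k -> measure_display}
  {X : forall i, measurableType (d i)}
  {dO : measure_display} {Omega : measurableType dO}.
Variables (mu : forall i, {measure set (X i) -> \bar R})
  (P : probability Omega R) (N : forall i, R.-ker Omega ~> X i)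
  (L0 : set (ktuple R X)) (s : ktuple R X).
Hypotheses (L0_calL : L0 `<=` calL mu) (L0s : L0 s)
  (intensity : has_intensity P N mu s).
Variables (z b M Sigma a c tau : R).
Hypotheses (z0 : (0 < z)%R) (z1 : (z < 1 - 1 / Num.sqrt 2)%R)
  (b0 : (0 <= b)%R) (M0 : (0 < M)%R) (a0 : (0 < a)%R) (c0 : (0 <= c)%R)
  (tauE : tau = (4 * (2 + c * z) / (a * z ^+ 2))%R).
Variables (I : countType) (Delta eta : I -> R) (Sm : I -> set (ktuple R X)).
Hypotheses (Delta1 : forall m, (1 <= Delta m)%R)
  (sumDelta : \esum_(m in [set: I]) (expR (- Delta m))%:E = Sigma%:E)
  (eta12 : forall m, (1 / 2 <= eta m)%R)
  (Sm_L0 : forall m, Sm m `<=` L0).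
Hypothesis deviation : forall y xi : R, (0 < y)%R -> (0 < xi)%R ->
  ereal_sup [set P [set w | xi%:E < Zproc mu s (fun i => N i w) t t'] |
               t in hell_ball mu L0 s y & t' in hell_ball mu L0 s y]
  <= (b * expR (- (a * xi ^+ 2 / (y ^+ 2 + c * xi))))%:E.
Hypothesis entropy : forall m (s' : ktuple R X) (r : R),
  L0 s' -> (2 * eta m <= r)%R ->
  card_le_real (Sm m `&` hell_ball mu L0 s' (r * Num.sqrt tau)%R)
    (M * expR (r ^+ 2 / 2))%R.
Variable pen : ktuple R X -> \bar R.
Hypothesis penE : forall t, (\bigcup_m Sm m) t ->
  pen t = (z * tau)%:E *
    ereal_inf [set (4 * eta m ^+ 2 + Delta m)%:E | m in [set m | Sm m t]].
Implicit Types (t u : ktuple R X) (m : I) (n : nat).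

Let sL : calL mu s. Proof. exact: L0_calL. Qed.

Let Sm_calL m t : Sm m t -> calL mu t.
Proof. by move=> /Sm_L0/L0_calL. Qed.

Let tau_eq : (tau * (a * z ^+ 2) = 4 * (2 + c * z))%R.
Proof. by rewrite tauE divfK// gt_eqF// mulr_gt0// exprn_gt0. Qed.

Let tau0 : (0 < tau)%R.
Proof.
rewrite tauE divr_gt0// ?mulr_gt0 ?exprn_gt0//.
by rewrite ltr_wpDr// mulr_ge0// ltW.
Qed.

Let eta2 m : (1 / 4 <= eta m ^+ 2)%R.
Proof. by have := eta12 m; nra. Qed.

(** The penalty is an infimum over the models containing t; since all terms
    are at least 1, some model comes within a factor 2 of it. *)
Lemma penalty_spec t : (\bigcup_m Sm m) t -> exists p : R,
  [/\ pen t = p%:E, (0 <= p)%R,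
      forall m, Sm m t -> (p <= z * tau * (4 * eta m ^+ 2 + Delta m))%R &
      exists2 m, Sm m t & (z * tau * (2 * eta m ^+ 2 + Delta m / 2) < p)%R].
Proof.
move=> St; rewrite penE//; set Q := image _ _.
have zt0 : (0 < z * tau)%R by rewrite mulr_gt0.
have infge1 : 1 <= ereal_inf Q.
  apply: le_ereal_inf_tmp => _ [m _ <-]; rewrite lee_fin.
  by have := Delta1 m; have := eta2 m; lra.
have infle m : Sm m t -> ereal_inf Q <= (4 * eta m ^+ 2 + Delta m)%:E.
  by move=> Smt; apply: ereal_inf_lbound; exists m.
have [m0 _ Sm0t] := St.
have : ereal_inf Q \is a fin_num.
  apply: fin_real; apply/andP; split; first exact: lt_le_trans (ltNyr _) infge1.
  exact: le_lt_trans (infle _ Sm0t) (ltry _).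
move=> /fineK; set q := fine _ => qE; rewrite -qE in infge1 infle *.
have q1 : (1 <= q)%R by rewrite -lee_fin.
exists (z * tau * q)%R; split => //.
- by rewrite mulr_ge0 ?ltW//; lra.
- by move=> m /infle; rewrite lee_fin ler_pM2l.
- have : ereal_inf Q < (2 * q)%:E by rewrite -qE lte_fin; lra.
  move=> /ereal_inf_lt[_ [m Smt <-]]; rewrite lte_fin => mq.
  by exists m => //; rewrite ltr_pM2l//; lra.
Qed.

(** The competitors of model m in the n-th shell around s are gathered in a
    ball of squared radius tau * radius2 m n: the term n + 1 covers the shell and
    the term 4 eta^2 makes the radius large enough for the entropy bound. *)
Let radius2 m n : R := (n.+1%:R + 4 * eta m ^+ 2)%R.
Let level m n : R := (n%:R + 2 * eta m ^+ 2 + Delta m / 2)%R.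
Let radius m n : R := (Num.sqrt (radius2 m n) * Num.sqrt tau)%R.

Let radius2_gt0 m n : (0 < radius2 m n)%R.
Proof. by rewrite /radius2 ltr_pwDl// mulr_ge0// sqr_ge0. Qed.

Let radius_sqr m n : (radius m n ^+ 2 = tau * radius2 m n)%R.
Proof. by rewrite exprMn !sqr_sqrtr ?ltW// mulrC. Qed.

Let radius_gt0 m n : (0 < radius m n)%R.
Proof. by rewrite mulr_gt0// sqrtr_gt0. Qed.

Let radius2_level m n : (radius2 m n <= 2 * level m n)%R.
Proof.
rewrite /radius2 /level; have := Delta1 m; have := ler0n R n.
by rewrite -(natr1 n); lra.
Qed.

Let level_gt0 m n : (0 < level m n)%R.
Proof. by have := radius2_gt0 m n; have := radius2_level m n; lra. Qed.

Let exceed t u m n : set Omega :=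
  [set w | (z * tau * level m n)%:E < Zproc mu s (fun i => N i w) t u].

(** With v = level, the deviation bound at xi = z tau v and y^2 <= 2 tau v has
    exponent at least a z^2 tau v / (2 + c z), and tau is chosen to make this
    4 v. *)
Lemma prob_exceed t u m n : hell_ball mu L0 s (radius m n) t ->
  hell_ball mu L0 s (radius m n) u ->
  P (exceed t u m n) <= (b * expR (- (4 * level m n)))%:E.
Proof.
move=> tB uB; have xi0 : (0 < z * tau * level m n)%R by rewrite !mulr_gt0.
apply: le_trans (le_trans (deviation (radius_gt0 m n) xi0) _).
  by apply: ereal_sup_ubound; exists t => //; exists u.
rewrite lee_fin ler_wpM2l// ler_expR lerN2 radius_sqr.
have cx0 : (0 <= c * (z * tau * level m n))%R by rewrite mulr_ge0// ltW.
rewrite ler_pdivlMr; last by rewrite ltr_wpDr// mulr_gt0.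
have -> : (a * (z * tau * level m n) ^+ 2 =
    tau * level m n ^+ 2 * (4 * (2 + c * z)))%R by rewrite -tau_eq; ring.
have -> : (tau * level m n ^+ 2 * (4 * (2 + c * z)) = 4 * level m n *
   (tau * (2 * level m n) + c * (z * tau * level m n)))%R by ring.
by rewrite ler_pM2l ?mulr_gt0// lerD2r ler_pM2l.
Qed.

(** The ball condition on t makes the deviation bound applicable; it costs
    nothing because only competitors farther from s than t matter. *)
Let bad t m n : set Omega :=
  if `[< hell_ball mu L0 s (radius m n) t >] then
    \bigcup_(u in Sm m `&` hell_ball mu L0 s (radius m n)) exceed t u m n
  else set0.

(** Since n + 1 <= exp n, the exponents add up to at most
    - 2.5 n + 1/2 - 6 eta^2 - 2 Delta, and eta^2 >= 1/4, Delta >= 1 leave room for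
    - Delta - (n + 1). *)
Let exponents m n :
  (n.+1%:R * (expR (radius2 m n / 2) * expR (- (4 * level m n))) <=
   expR (- Delta m) / (2 ^ n.+1)%:R)%R.
Proof.
apply: (@le_trans _ _ (expR n%:R *
    (expR (radius2 m n / 2) * expR (- (4 * level m n)))))%R.
  rewrite ler_wpM2r ?mulr_ge0 ?expR_ge0// -(natr1 n) addrC; exact: expR_ge1Dx.
rewrite -!expRD; apply: (@le_trans _ _ (expR (- Delta m) * expR (- n.+1%:R))%R).
  rewrite -expRD ler_expR /radius2 /level; have := ler0n R n.
  by have := Delta1 m; have := eta2 m; rewrite -(natr1 n); lra.
rewrite ler_pM2l ?expR_gt0// expRN lef_pV2 ?posrE ?expR_gt0 ?ltr0n ?expn_gt0//.
rewrite natrX -[in leRHS](mulr1 n.+1%:R) expRM_natl.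
by rewrite lerXn2r ?nnegrE ?expR_ge0//; have := @expR_ge1Dx R 1; lra.
Qed.

Lemma prob_bad t m n : calL mu t -> measurable (bad t m n) /\
  (tau * n.+1%:R)%:E * P (bad t m n) <=
    (tau * b * M * expR (- Delta m) / (2 ^ n.+1)%:R)%:E.
Proof.
move=> tL; rewrite /bad; case: asboolP => tB; last first.
  split => //; rewrite measure0 mule0 lee_fin divr_ge0//.
  by rewrite !mulr_ge0 ?expR_ge0// ltW.
have reta : (2 * eta m <= Num.sqrt (radius2 m n))%R.
  have e0 : (0 <= 2 * eta m)%R by have := eta12 m; lra.
  rewrite -(ger0_norm e0) -sqrtr_sqr ler_sqrt ?(ltW (radius2_gt0 m n))// /radius2.
  have : (0 <= n.+1%:R :> R)%R by [].
  by lra.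
have [card cardB cardM] := entropy L0s reta.
rewrite (sqr_sqrtr (ltW (radius2_gt0 m n))) in cardM.
have [| |mU PU] := measure_bigcup_card (P := P)
  (E := fun u => exceed t u m n) (p := (b * expR (- (4 * level m n)))%:E) cardB.
- by move=> u [/Sm_calL uL _]; exact: measurable_Zproc_gt.
- by move=> u [_ uB]; exact: prob_exceed.
have w0 : 0 <= (tau * n.+1%:R)%:E by rewrite lee_fin mulr_ge0// ltW.
split => //; apply: (le_trans (lee_wpmul2l w0 PU)).
rewrite -!EFinM lee_fin.
apply: (@le_trans _ _ (tau * b * M * (n.+1%:R *
    (expR (radius2 m n / 2) * expR (- (4 * level m n))))))%R; last first.
  by rewrite -[leRHS]mulrA ler_wpM2l ?exponents// !mulr_ge0// ltW.
have -> : (tau * b * M * (n.+1%:R * (expR (radius2 m n / 2) *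
    expR (- (4 * level m n)))) = tau * n.+1%:R * (M * expR (radius2 m n / 2) *
    (b * expR (- (4 * level m n)))))%R by ring.
by rewrite ler_wpM2l// ler_wpM2r// mulr_ge0// expR_ge0.
Qed.

(** Models are indexed by their codes to form a series. *)
Let badnat t i n := if pickle_inv i is Some m then bad t m n else set0.

Let excess t w : \bar R :=
  \sum_(i <oo) \sum_(n <oo) (tau * n.+1%:R)%:E * (\1_(badnat t i n) w)%:E.

Let weight_ge0 (i n : nat) : (0 <= tau * n.+1%:R)%R.
Proof. by rewrite mulr_ge0// ltW. Qed.

Let excess_ge0 t w : 0 <= excess t w.
Proof.
apply: nneseries_ge0 => i _ _; apply: nneseries_ge0 => n _ _.
by rewrite mule_ge0 ?lee_fin ?weight_ge0.
Qed.

Let measurable_badnat t i n : calL mu t -> measurable (badnat t i n).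
Proof.
move=> tL; rewrite /badnat; case: pickle_inv => [m|//].
by have [] := prob_bad m n tL.
Qed.

Lemma expected_excess t : calL mu t ->
  \int[P]_w excess t w <= (tau * b * M * Sigma)%:E.
Proof.
move=> tL; have mbad i n := measurable_badnat i n tL.
rewrite (integral_weighted_events P weight_ge0 mbad).2.
have tbM0 : (0 <= tau * b * M)%R by rewrite !mulr_ge0// ltW.
pose g i : \bar R := if pickle_inv i is Some m then (expR (- Delta m))%:E else 0.
have g0 i : 0 <= g i.
  by rewrite /g; case: pickle_inv => [m|//]; rewrite lee_fin expR_ge0.
apply: (@le_trans _ _ (\sum_(i <oo) (tau * b * M)%:E * g i)).
  apply: lee_nneseries => [i _ _|i _].
    by apply: nneseries_ge0 => n _ _; rewrite mule_ge0 ?lee_fin ?weight_ge0.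
  rewrite /g /badnat; case: (pickle_inv i) => [m|]; last first.
    by rewrite mule0 eseries0// => n _ _; rewrite measure0 mule0.
  rewrite -EFinM; apply: le_trans (epsilon_trick0 xpredT _).
    apply: lee_nneseries => [n _ _|n _].
      by rewrite mule_ge0 ?lee_fin ?weight_ge0.
    exact: (prob_bad m n tL).2.
  by rewrite mulr_ge0 ?expR_ge0.
by rewrite nneseriesZl// nneseries_pickle ?sumDelta// => m; rewrite lee_fin expR_ge0.
Qed.

Let kappa : R := (1 - 1 / Num.sqrt 2)%R.

(** If v beats t, then either v is within a multiple of the risk and penalty of
    t, or the centred process exceeds both z times the squared distance from v
    to s and the penalty of v, an event recorded in the excess. *)
Lemma beaten_by_near_or_excess t p v w :
  (\bigcup_m Sm m) t -> pen t = p%:E -> (0 <= p)%R ->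
  (forall i, N i w [set: X i] < +oo) -> (\bigcup_m Sm m) v ->
  0 <= Tstat mu pen (fun i => N i w) t v ->
  (hellr2 mu s v)%:E <=
    (((2 - kappa) * hellr2 mu s t + p) / (kappa - z))%:E + excess t w.
Proof.
move=> St pt p0 Nfin Sv Ttv.
have [[mt _ Smt] [mv _ Smv]] := (St, Sv).
have [tL vL] := (Sm_calL Smt, Sm_calL Smv).
have [q [pv _ _ [m Smvm qm]]] := penalty_spec Sv.
have ht0 := hellr2_ge0 mu s t; have hv0 := hellr2_ge0 mu s v.
have kz : (0 < kappa - z)%R by rewrite subr_gt0.
have k1 : (kappa <= 1)%R by rewrite /kappa lerBlDr lerDl divr_ge0.
set K := (_ / _)%R.
have K0 : (0 <= K)%R by rewrite divr_ge0 ?(ltW kz)// addr_ge0// mulr_ge0//; lra.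
have [hK|Kh] := leP (hellr2 mu s v) K.
  by rewrite -[leLHS]adde0 leeD ?lee_fin// excess_ge0.
rewrite /K ltr_pdivrMr// in Kh.
have /andP[n1 n2] := truncn_itv (divr_ge0 hv0 (ltW tau0)).
move: n1 n2; set n := Num.truncn _; rewrite ler_pdivlMr// ltr_pdivrMr// => n1 n2.
have nrad : (n.+1%:R * tau <= radius m n ^+ 2)%R.
  rewrite radius_sqr mulrC ler_pM2l// /radius2 lerDl.
  by have := eta2 m; lra.
have thv : (hellr2 mu s t <= hellr2 mu s v)%R.
  have : (0 <= hellr2 mu s t * (1 - kappa))%R by rewrite mulr_ge0// subr_ge0.
  have : (0 <= hellr2 mu s v * (1 - kappa + z))%R.
    by rewrite mulr_ge0// addr_ge0 ?subr_ge0// ltW.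
  move: Kh; move: kappa => kap; lra.
have tball : hell_ball mu L0 s (radius m n) t.
  by split; [exact: Sm_L0 Smt | rewrite le_hell ?(ltW (radius_gt0 m n))//; lra].
have vball : hell_ball mu L0 s (radius m n) v.
  by split; [exact: Sm_L0 Smv | rewrite le_hell ?(ltW (radius_gt0 m n))//; lra].
apply: (@le_trans _ _ (excess t w)); last by rewrite leeDr// lee_fin.
apply: (@le_trans _ _ (tau * n.+1%:R)%:E); first by rewrite lee_fin mulrC ltW.
apply: (@weighted_events_ge _ _ _ (fun _ j => tau * j.+1%:R)%R (badnat t)
  (pickle m) n w) => //.
rewrite /badnat pickleK_inv /bad; case: asboolP => // _; exists v => //.
apply: lt_le_trans (Tstat_le_Zproc Nfin sL tL vL pt pv Ttv).
rewrite lte_fin /level.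
have : (z * (n%:R * tau) <= z * hellr2 mu s v)%R by rewrite ler_pM2l.
move: Kh qm; rewrite -/kappa (_ : 1 + 1 / Num.sqrt 2 = 2 - kappa)%R; last first.
  by rewrite /kappa; lra.
by lra.
Qed.

(** For almost every w the random measures are finite, and there
    [selection_bound] applies with the near radius of
    [beaten_by_near_or_excess] increased by the excess at w. *)
Lemma oracle_bound (shat : Omega -> ktuple R X) t p :
  (\bigcup_m Sm m) t -> pen t = p%:E -> (0 <= p)%R ->
  (forall w, (\bigcup_m Sm m) (shat w)) ->
  (forall w, calD mu pen (fun i => N i w) (\bigcup_m Sm m) (shat w) <=
     calD mu pen (fun i => N i w) (\bigcup_m Sm m) t + tau%:E) ->
  \int[P]_w hell2 mu s (shat w) <=
    (6 * hellr2 mu s t + 4 * (((2 - kappa) * hellr2 mu s t + p) / (kappa - z))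
     + 2 * tau + 4 * (tau * b * M * Sigma))%:E.
Proof.
move=> St pt p0 Sshat sel; have [mt _ Smt] := St; have tL := Sm_calL Smt.
have ht0 := hellr2_ge0 mu s t.
have kz : (0 < kappa - z)%R by rewrite subr_gt0.
have k1 : (kappa <= 1)%R by rewrite /kappa lerBlDr lerDl divr_ge0.
set K := (_ / (kappa - z))%R.
have K0 : (0 <= K)%R by rewrite divr_ge0 ?(ltW kz)// addr_ge0// mulr_ge0//; lra.
set C0 := (6 * _ + 4 * K + 2 * tau)%R.
have C00 : (0 <= C0)%R by rewrite !addr_ge0// mulr_ge0// ltW.
have SL : \bigcup_m Sm m `<=` calL mu by move=> u [m _ /Sm_calL].
have shatE w : hell2 mu s (shat w) = (hellr2 mu s (shat w))%:E.
  by rewrite hell2E//; exact: SL.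
have mexcess : measurable_fun [set: Omega] (excess t).
  have mbad i n := measurable_badnat i n tL.
  exact: (integral_weighted_events P weight_ge0 mbad).1.
apply: (@le_trans _ _ (\int[P]_w (C0%:E + 4%:E * excess t w))).
  apply: ge0_ae_le_integralT.
  - by move=> w; rewrite shatE lee_fin hellr2_ge0.
  - by move=> w; rewrite adde_ge0 ?mule_ge0 ?lee_fin.
  - apply: emeasurable_funD; first exact: measurable_cst.
    exact: measurable_funeM.
  have := ae_random_measure_finite intensity; apply: filterS => w Nfin.
  rewrite shatE; case Ew : (excess t w) => [g| |]; last 2 first.
  - by rewrite gt0_muley ?lte_fin// addey// leey.
  - by have := excess_ge0 t w; rewrite Ew.
  have g0 : (0 <= g)%R by rewrite -lee_fin -Ew.
  rewrite -EFinM -EFinD lee_fin.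
  have pen_fin u : (\bigcup_m Sm m) u -> pen u \is a fin_num.
    by move=> /penalty_spec[q [-> _ _ _]].
  have near v : (\bigcup_m Sm m) v -> 0 <= Tstat mu pen (fun i => N i w) t v ->
      (hellr2 mu s v <= K + g)%R.
    move=> Sv Ttv; rewrite -lee_fin EFinD -Ew.
    exact: beaten_by_near_or_excess.
  have := selection_bound Nfin pen_fin SL sL St (Sshat w) (addr_ge0 K0 g0)
    (ltW tau0) (sel w) near.
  by rewrite /C0; lra.
rewrite ge0_integralD//; first last.
- exact: measurable_funeM.
- by move=> w _; rewrite mule_ge0 ?lee_fin.
rewrite integral_cst// [X in _ * X + _]probability_setT mule1.
rewrite ge0_integralZl ?lee_fin//.
rewrite [leRHS]EFinD leeD2l// EFinM lee_wpmul2l ?lee_fin//.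
exact: expected_excess.
Qed.

End OracleBound.

(** * Infima over models and competitors *)

Section Infima.
Context {R : realType}.

Lemma le_mul_ereal_inf (I : Type) (E : \bar R) (C : R) (g : I -> \bar R) :
  (0 < C)%R -> (forall m, E <= C%:E * g m) ->
  E <= C%:E * ereal_inf [set g m | m in [set: I]].
Proof.
move=> C0 Eg; rewrite -lee_pdivrMl//; apply: le_ereal_inf_tmp => _ [m _ <-].
by rewrite lee_pdivrMl.
Qed.

Context {k : nat} {d : 'I_k -> measure_display}
  {X : forall i, measurableType (d i)}.
Variable mu : forall i, {measure set (X i) -> \bar R}.
Implicit Types (s : ktuple R X) (F : set (ktuple R X)).

(** The square root of the bound is below each distance, hence below their
    infimum; squaring then needs only monotonicity. *)
Lemma le_hell_set_sqr s F (r : R) :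
  (forall t, F t -> r%:E <= hell mu s t ^+ 2) -> r%:E <= hell_set mu s F ^+ 2.
Proof.
move=> rF; have rt : sqrte r%:E <= hell_set mu s F.
  apply: le_ereal_inf_tmp => _ [t Ft <-].
  rewrite -[leRHS]gee0_abs ?sqrte_ge0// -sqrte_sqr lee_sqrt ?rF//.
  by rewrite expe2 mule_ge0// sqrte_ge0.
apply: (@le_trans _ _ (sqrte r%:E ^+ 2)); last first.
  by rewrite !expe2 lee_pmul// sqrte_ge0.
have [r0|r0] := leP 0%R r; first by rewrite sqr_sqrte.
by rewrite (@le_trans _ _ 0)// ?lee_fin ?(ltW r0)// expe2 mule_ge0// sqrte_ge0.
Qed.

Lemma le_hell_set_bound s F (E : \bar R) (C Q : R) : calL mu s ->
  F `<=` calL mu -> (0 < C)%R -> 0 <= E ->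
  (forall t, F t -> E <= (C * (hellr2 mu s t + Q))%:E) ->
  E <= C%:E * (hell_set mu s F ^+ 2 + Q%:E).
Proof.
move=> sL FL C0 E0 EF.
have [[t Ft]|F0] := pselect (exists t, F t); last first.
  have {}F0 : F = set0 by apply/seteqP; split => // t Ft; apply: F0; exists t.
  rewrite /hell_set F0 image_set0 ereal_inf0 expe2 mulyy addye//.
  by rewrite gt0_muley ?leey ?lte_fin.
have : E \is a fin_num by rewrite ge0_fin_numE// (le_lt_trans (EF t Ft))// ltry.
move=> /fineK Ee; rewrite -Ee in EF *; move: (fine E) EF => e EF {Ee}.
rewrite -lee_pdivrMl// -EFinM -leeBlDr// -EFinB.
apply: le_hell_set_sqr => u Fu; rewrite hell_sqr//; last exact: FL.
rewrite lee_fin lerBlDr ler_pdivrMl//.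
by rewrite -lee_fin; exact: EF.
Qed.

End Infima.

Theorem proposition6 (R : realType) (z b M Sigma : R)
  (hz0 : (0 < z)%R) (hz1 : (z < 1 - 1 / Num.sqrt 2)%R)
  (hb : (0 <= b)%R) (hM : (0 < M)%R) :
  exists C C' : R, forall
    (k : nat) (hk : (0 < k)%N)
    (d : 'I_k -> measure_display) (X : forall i, measurableType (d i))
    (mu : forall i, {measure set (X i) -> \bar R})
    (dO : measure_display) (Omega : measurableType dO)
    (P : probability Omega R)
    (N : forall i, R.-ker Omega ~> X i)
    (L0 : set (ktuple R X)) (s : ktuple R X)
    (hL0 : L0 `<=` calL mu) (hs : L0 s)
    (hindep : indep_random_measures P N)
    (hint : has_intensity P N mu s)
    (a c tau : R) (ha : (0 < a)%R) (hc : (0 <= c)%R)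
    (htau : tau = (4 * (2 + c * z) / (a * z ^+ 2))%R)
    (I : countType) (Delta : I -> R)
    (hDelta : forall m, (1 <= Delta m)%R)
    (hSigma : \esum_(m in [set: I]) (expR (- Delta m))%:E = Sigma%:E)
    (hZ : forall y xi : R, (0 < y)%R -> (0 < xi)%R ->
      ereal_sup [set P [set w | xi%:E < Zproc mu s (fun i => N i w) t t'] |
                   t in hell_ball mu L0 s y & t' in hell_ball mu L0 s y]
      <= (b * expR (- (a * xi ^+ 2 / (y ^+ 2 + c * xi))))%:E)
    (Lam : Type) (Lambda : I -> set Lam) (f : Lam -> ktuple R X)
    (hS : forall m, f @` Lambda m `<=` L0)
    (hdiscr : forall m, hell_discrete mu (f @` Lambda m))
    (eta : I -> R) (heta : forall m, (1 / 2 <= eta m)%R)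
    (hcard : forall m (s' : ktuple R X) (r : R),
      L0 s' -> (2 * eta m <= r)%R ->
      card_le_real (f @` Lambda m `&` hell_ball mu L0 s' (r * Num.sqrt tau)%R)
        (M * expR (r ^+ 2 / 2))%R)
    (pen : ktuple R X -> \bar R)
    (hpen : forall t, (\bigcup_m (f @` Lambda m)) t ->
      pen t = (z * tau)%:E *
        ereal_inf [set (4 * eta m ^+ 2 + Delta m)%:E |
                     m in [set m | (f @` Lambda m) t]])
    (lamhat : Omega -> Lam)
    (hsel : forall w, is_selected mu pen (fun i => N i w)
      (\bigcup_m Lambda m) f tau (lamhat w)),
    \int[P]_w hell2 mu s (f (lamhat w)) <=
      C%:E * ereal_inf [set hell_set mu s (f @` Lambda m) ^+ 2 +
                          (tau * Num.max (eta m ^+ 2) (Delta m))%:E |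
                          m in [set: I]]
    /\
    forall (S : I -> set (ktuple R X)) (D : I -> R),
      (forall m, is_net mu L0 M (eta m * Num.sqrt tau)%R (D m)
                   (f @` Lambda m) (S m)) ->
      (forall m, (eta m ^+ 2 = 2 * Num.max (D m) (1 / 8))%R) ->
      \int[P]_w hell2 mu s (f (lamhat w)) <=
        C'%:E * ereal_inf [set hell_set mu s (S m) ^+ 2 +
                             (tau * Num.max (D m) (Delta m))%:E |
                             m in [set: I]].
Proof.
pose kz := (1 - 1 / Num.sqrt 2 - z : R)%R.
have kz0 : (0 < kz)%R by rewrite subr_gt0.
have s20 : (0 <= 1 / Num.sqrt 2 :> R)%R by rewrite divr_ge0.
(* in the oracle bound, 6 H2(s,t) + 2 tau gives the term 8, the near radius,
   with pen t <= 5 tau q, gives 20 / kz, and the excess gives the last term;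
   q stands for the maximum of eta^2 and Delta, which is at least 1 *)
pose C := (8 + 20 / kz + 4 * b * M * `|Sigma|)%R.
have C0 : (0 < C)%R.
  by rewrite /C ltr_pwDl ?mulr_ge0 ?(ltW hM)// ltr_pwDl ?divr_ge0 ?(ltW kz0).
(* for the net point t' of t, H2(s,t') <= 2 H2(s,t) + 2 tau eta^2, while eta^2 and
   Delta are both at most 2 max(D, Delta): the coefficient of tau max(D, Delta)
   becomes 2 * 2 + 2 = 6 *)
exists C, (6 * C)%R => k hk d X mu dO Omega P N L0 s hL0 hs _ hint a c tau ha hc
  htau I Delta hDelta hSigma hZ Lam Lambda f hS _ eta heta hcard pen hpen
  lamhat hsel.
have tau0 : (0 < tau)%R.
  rewrite htau divr_gt0 ?mulr_gt0 ?exprn_gt0//.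
  by rewrite ltr_wpDr// mulr_ge0// ltW.
have sL := hL0 _ hs.
pose Sm m := f @` Lambda m.
have SmE : f @` (\bigcup_m Lambda m) = \bigcup_m Sm m by rewrite image_bigcup.
have Sshat w : (\bigcup_m Sm m) (f (lamhat w)).
  by rewrite -SmE; exists (lamhat w) => //; have [] := hsel w.
have risk0 : 0 <= \int[P]_w hell2 mu s (f (lamhat w)).
  apply: integral_ge0 => w _; have [m _ Smw] := Sshat w.
  by rewrite hell2E ?lee_fin ?hellr2_ge0//; exact: hL0 _ (hS _ _ Smw).
have risk m t : Sm m t -> \int[P]_w hell2 mu s (f (lamhat w)) <=
    (C * (hellr2 mu s t + tau * Num.max (eta m ^+ 2) (Delta m)))%:E.
  move=> Smt; have St : (\bigcup_m Sm m) t by exists m.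
  have [p [pt p0 pm _]] :=
    penalty_spec hz0 ha hc htau hDelta heta hpen St.
  have sel w : calD mu pen (fun i => N i w) (\bigcup_m Sm m) (f (lamhat w)) <=
      calD mu pen (fun i => N i w) (\bigcup_m Sm m) t + tau%:E.
    have [_] := hsel w; rewrite SmE.
    by case: Smt => l Ll <-; apply; exists m.
  apply: le_trans (oracle_bound hL0 hs hint hz0 hz1 hb hM ha hc htau hDelta
    hSigma heta hS hZ hcard hpen St pt p0 Sshat sel) _.
  have h0 := hellr2_ge0 mu s t; have pm' := pm m Smt.
  have qeta : (eta m ^+ 2 <= Num.max (eta m ^+ 2) (Delta m))%R.
    by rewrite le_max lexx.
  have qDelta : (Delta m <= Num.max (eta m ^+ 2) (Delta m))%R.
    by rewrite le_max lexx orbT.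
  have q1 := le_trans (hDelta m) qDelta.
  rewrite lee_fin -/kz; move: pm' qeta qDelta q1; move: (Num.max _ _) => q.
  move: (hellr2 mu s t) h0 => h h0 pm' qeta qDelta q1.
  have tq0 : (tau <= tau * q)%R by rewrite ler_peMr// ltW.
  have pq : (p <= 5 * (tau * q))%R.
    apply: (le_trans pm'); rewrite -mulrA.
    apply: (@le_trans _ _ (tau * (4 * eta m ^+ 2 + Delta m)))%R.
      rewrite ler_piMl//; last by rewrite (ltW (lt_le_trans hz1 _))// gerBl.
      apply: mulr_ge0; first exact: ltW.
      by have := sqr_ge0 (eta m); have := hDelta m; lra.
    by rewrite [leRHS]mulrCA ler_pM2l//; lra.
  have num : ((2 - (1 - 1 / Num.sqrt 2)) * h + p <= 5 * (h + tau * q))%R.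
    have : ((2 - (1 - 1 / Num.sqrt 2)) * h <= 2 * h)%R.
      by rewrite ler_wpM2r//; move: hz0 hz1; lra.
    by lra.
  have frac : (((2 - (1 - 1 / Num.sqrt 2)) * h + p) / kz <=
      5 / kz * (h + tau * q))%R.
    by rewrite mulrAC ler_pM2r ?invr_gt0.
  have last : (tau * b * M * Sigma <= b * M * `|Sigma| * (h + tau * q))%R.
    rewrite (_ : tau * b * M * Sigma = b * M * (Sigma * tau))%R; last by ring.
    rewrite -[leRHS]mulrA ler_wpM2l ?mulr_ge0 ?(ltW hM)//.
    apply: (@le_trans _ _ (`|Sigma| * tau))%R.
      by rewrite ler_wpM2r ?(ltW tau0)// ler_norm.
    by rewrite ler_wpM2l//; lra.
  have -> : (C * (h + tau * q) = 8 * (h + tau * q) + 4 * (5 / kz * (h + tau * q))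
      + 4 * (b * M * `|Sigma| * (h + tau * q)))%R by rewrite /C; ring.
  by move: frac last; lra.
split.
  apply: le_mul_ereal_inf => // m; apply: le_hell_set_bound => //.
  - by move=> t /hS/hL0.
  - exact: risk.
move=> S D hnet hD; apply: le_mul_ereal_inf; first by rewrite mulr_gt0.
move=> m; have [SL0 _ TS approx _] := hnet m.
apply: le_hell_set_bound => //.
- by move=> t /SL0/hL0.
- by rewrite mulr_gt0.
move=> t St; have [t' Tt' tt'] := approx t St.
have [tL t'L] := (hL0 _ (SL0 _ St), hL0 _ (SL0 _ (TS _ Tt'))).
have e0 : (0 <= eta m * Num.sqrt tau)%R.
  by rewrite mulr_ge0// (le_trans _ (heta m)).
rewrite le_hell// exprMn (sqr_sqrtr (ltW tau0)) in tt'.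
apply: le_trans (risk m t' Tt') _; rewrite lee_fin.
rewrite -[(6 * C)%R]mulrC -mulrA ler_pM2l//.
have tri := hellr2_triangle tL sL t'L; rewrite (hellr2C mu t s) in tri.
have qD : (D m <= Num.max (D m) (Delta m))%R by rewrite le_max lexx.
have qDelta : (Delta m <= Num.max (D m) (Delta m))%R by rewrite le_max lexx orbT.
have etaq : (eta m ^+ 2 <= 2 * Num.max (D m) (Delta m))%R.
  rewrite hD ler_pM2l// ge_max qD/=.
  by have := hDelta m; lra.
have maxq : (Num.max (eta m ^+ 2) (Delta m) <= 2 * Num.max (D m) (Delta m))%R.
  by rewrite ge_max etaq/=; have := hDelta m; lra.
have h0 := hellr2_ge0 mu s t.
move: etaq maxq {qD qDelta}.
set q := Num.max (D m) _; set q' := Num.max _ _ => etaq maxq.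
have : (tau * eta m ^+ 2 <= tau * (2 * q))%R by rewrite ler_pM2l.
have : (tau * q' <= tau * (2 * q))%R by rewrite ler_pM2l.
by move: tri tt'; lra.
Qed.
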